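(* When $R=3$, the group $\mathrm{G}_2'$ of algebra automorphisms of the split octonions $\mathbb{O}'$ acts on $\mathrm{P}C$ (via its linear action on $\mathbb{I}$, which preserves $Q$) in a way that maps lines to lines.
   Context: $\mathbb{H}$ denotes the quaternions with conjugation $x\mapsto\overline{x}$ and norm $|x|^2=x\overline{x}$; $\mathrm{Im}(\mathbb{H})=\{x\in\mathbb{H}:\overline{x}=-x\}$ is identified with $\mathbb{R}^3$. $S^2$ is the set of unit vectors in $\mathrm{Im}(\mathbb{H})\cong\mathbb{R}^3$, and $\mathrm{SU}(2)$ is identified with the group of unit quaternions. The double cover $\mathrm{SU}(2)\to\mathrm{SO}(3)$ sends $q$ to the rotation $x\mapsto qxq^{-1}$ of $\mathrm{Im}(\mathbb{H})$. The split octonions $\mathbb{O}'$ are the real vector space $\mathbb{H}\oplus\mathbb{H}$ with product $(a,b)(c,d)=(ac+d\overline{b},\,\overline{a}d+cb)$, conjugation $\overline{(a,b)}=(\overline{a},-b)$ and quadratic form $Q(a,b)=|a|^2-|b|^2$. Its automorphism group $\mathrm{G}_2'$ is the (adjoint) split real form of $\mathrm{G}_2$. The imaginary split octonions are $\mathbb{I}=\{x\in\mathbb{O}':\overline{x}=-x\}=\mathrm{Im}(\mathbb{H})\oplus\mathbb{H}$. Let $C=\{x\in\mathbb{I}:Q(x)=0\}$ and $\mathrm{P}C=\{x\in C:x\neq0\}/\mathbb{R}^*$. A point of $\mathrm{P}C$ is written $\pm(v,q)$, the class of a vector $(v,q)$ with $|v|=|q|=1$. Lines (these depend on the radius $R$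 of a fixed ball on which a ball of radius $1$ rolls): - A line in $S^2\times\mathrm{SO}(3)$ is any subset of the form $\{(\cos(\Phi)u+\sin(\Phi)v,\ \mathbf{R}(u\times v,(1+R)\Phi)\,g):\Phi\in\mathbb{R}\}$ with $u,v\in\mathbb{R}^3$ orthogonal unit vectors and $g\in\mathrm{SO}(3)$, where $\mathbf{R}(w,\alpha)$ is the right-handed rotation by angle $\alpha$ about the unit vector $w$. - A line in $S^2\times\mathrm{SU}(2)$ is the inverse image of a line in $S^2\times\mathrm{SO}(3)$ under the covering map $S^2\times\mathrm{SU}(2)\to S^2\times\mathrm{SO}(3)$. - A line in $\mathbb{R}\mathrm{P}^2\times\mathrm{SU}(2)$ is the image of a line in $S^2\times\mathrm{SU}(2)$ under the double cover $(v,q)\mapsto(\pm v,q)$. - A line in $\mathrm{P}C$ is the image of a line in $\mathbb{R}\mathrm{P}^2\times\mathrm{SU}(2)$ under the diffeomorphism $\tau\colon\mathbb{R}\mathrm{P}^2\times\mathrm{SU}(2)\to\mathrm{P}C$, $(\pm v,q)\mapsto\pm(v,vq)$.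
   Formalization: A line in S²×SU(2) is taken to be a connected component of the inverse image of a line in S²×SO(3), not the whole inverse image: for R=3 that is two disjoint circles, and G2' does not preserve the resulting pairs of curves in PC. *)

(* Defs.v *)
From HB Require Import structures.
From mathcomp Require Import all_boot all_order all_algebra.
From mathcomp Require Import all_classical all_reals all_analysis.
From mathcomp Require Import ring lra.

Set Implicit Arguments.
Unset Strict Implicit.
Unset Printing Implicit Defensive.

Import Order.TTheory GRing.Theory Num.Theory.
Import numFieldNormedType.Exports.

Local Open Scope classical_set_scope.
Local Open Scope ring_scope.

Section R3.
Variable R : realType.
Implicit Types (u v w x : 'cV[R]_3) (A : 'M[R]_3) (alpha : R).

Definition dotv u v : R := (u^T *m v) 0 0.

(* The indices are added in 'I_3, that is, modulo 3. *)
Definition crossv u v : 'cV[R]_3 :=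
  \col_(i < 3) (u (i + 1) 0 * v (i + 2) 0 - u (i + 2) 0 * v (i + 1) 0).

(* The matrix of a linear map f, acting on column vectors. *)
Definition mxcol_of (f : 'cV[R]_3 -> 'cV[R]_3) : 'M[R]_3 :=
  \matrix_(i, j) f (delta_mx j 0) i 0.

(* Rodrigues' formula for the right-handed rotation by alpha about the unit
   vector w. *)
Definition rotmx w alpha : 'M[R]_3 :=
  mxcol_of (fun x => cos alpha *: x + sin alpha *: crossv w x
                     + ((1 - cos alpha) * dotv w x) *: w).

Definition S2 : set 'cV[R]_3 := [set v | dotv v v = 1].

Definition SO3 : set 'M[R]_3 := [set A | A *m A^T = 1%:M /\ \det A = 1].

Lemma dotvE u v :
  dotv u v = u 0 0 * v 0 0 + u 1 0 * v 1 0 + u 2 0 * v 2 0.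
Proof.
rewrite /dotv mxE !big_ord_recl big_ord0 !mxE addr0 addrA.
by congr (_ + u _ _ * v _ _ + u _ _ * v _ _); apply: val_inj.
Qed.

Lemma crossvE u v :
  (crossv u v 0 0 = u 1 0 * v 2 0 - u 2 0 * v 1 0) *
  (crossv u v 1 0 = u 2 0 * v 0 0 - u 0 0 * v 2 0) *
  (crossv u v 2 0 = u 0 0 * v 1 0 - u 1 0 * v 0 0).
Proof.
have e0 : (1 + 2 : 'I_3) = 0 by apply: val_inj.
have e1 : (2 + 2 : 'I_3) = 1 by apply: val_inj.
have e2 : (1 + 1 : 'I_3) = 2 by apply: val_inj.
have e3 : (2 + 1 : 'I_3) = 0 by apply: val_inj.
by rewrite !mxE !add0r e0 e1 e2 e3.
Qed.

Lemma cv3P u v :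
  u 0 0 = v 0 0 -> u 1 0 = v 1 0 -> u 2 0 = v 2 0 -> u = v.
Proof.
move=> h0 h1 h2; apply/matrixP => i j; rewrite ord1.
case: i => [[|[|[|//]]] lt_i].
- by rewrite (_ : Ordinal lt_i = 0) //; apply: val_inj.
- by rewrite (_ : Ordinal lt_i = 1) //; apply: val_inj.
- by rewrite (_ : Ordinal lt_i = 2) //; apply: val_inj.
Qed.

End R3.

(* The quaternion a + x i + y j + z k is the pair of its real part a and of the
   column vector (x, y, z). *)
Definition quat (R : realType) : Type := (R^o * 'cV[R]_3)%type.

HB.instance Definition _ (R : realType) :=
  GRing.Lmodule.copy (quat R) (R^o * 'cV[R]_3)%type.
HB.instance Definition _ (R : realType) :=
  Topological.copy (quat R) (R^o * 'cV[R]_3)%type.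

Section Quaternions.
Variable R : realType.
Implicit Types p q : quat R.

Definition qmul p q : quat R :=
  (p.1 * q.1 - dotv p.2 q.2, p.1 *: q.2 + q.1 *: p.2 + crossv p.2 q.2).

Definition qone : quat R := (1, 0).

Definition qconj q : quat R := (q.1, - q.2).

Definition imq (v : 'cV[R]_3) : quat R := (0, v).

Lemma qmulA : associative qmul.
Proof.
move=> [a u] [b v] [c w]; rewrite /qmul /=; congr pair.
  by rewrite !dotvE !(crossvE, mxE); ring.
by apply: cv3P; rewrite !dotvE !(crossvE, mxE); ring.
Qed.

Lemma qmul1 : left_id qone qmul.
Proof.
move=> [a u]; rewrite /qmul /qone /=; congr pair.
  by rewrite !dotvE !mxE; ring.
by apply: cv3P; rewrite !(crossvE, mxE); ring.
Qed.

Lemma qmulq1 : right_id qone qmul.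
Proof.
move=> [a u]; rewrite /qmul /qone /=; congr pair.
  by rewrite !dotvE !mxE; ring.
by apply: cv3P; rewrite !(crossvE, mxE); ring.
Qed.

Lemma qmulDl : left_distributive qmul +%R.
Proof.
move=> [a u] [b v] [c w]; rewrite /qmul /=; congr pair.
  by rewrite /= !dotvE !mxE; ring.
by apply: cv3P; rewrite /= !(crossvE, mxE); ring.
Qed.

Lemma qmulDr : right_distributive qmul +%R.
Proof.
move=> [a u] [b v] [c w]; rewrite /qmul /=; congr pair.
  by rewrite /= !dotvE !mxE; ring.
by apply: cv3P; rewrite /= !(crossvE, mxE); ring.
Qed.

Lemma qone_neq0 : qone != 0.
Proof. by apply/eqP => -[/eqP]; rewrite oner_eq0. Qed.

HB.instance Definition _ := GRing.Zmodule_isNzRing.Build (quat R)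
  qmulA qmul1 qmulq1 qmulDl qmulDr qone_neq0.

(* The square |q|^2 = q * qconj q of the Euclidean norm; the library's `|q| is
   the sup norm on a product. *)
Definition qnorm2 q : R := (q * qconj q).1.

Lemma qnorm2E q : qnorm2 q = q.1 ^+ 2 + dotv q.2 q.2.
Proof. by rewrite /qnorm2 /= !dotvE !mxE; ring. Qed.

Lemma mulq_conj q : q * qconj q = qnorm2 q *: (1 : quat R).
Proof.
case: q => a u; rewrite /qnorm2; congr pair => /=; first by rewrite [RHS]mulr1.
by apply: cv3P; rewrite !(crossvE, mxE); ring.
Qed.

Lemma mul_conjq q : qconj q * q = qnorm2 q *: (1 : quat R).
Proof.
case: q => a u; rewrite /qnorm2; congr pair => /=.
  by rewrite [RHS]mulr1 !dotvE !mxE; ring.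
by apply: cv3P; rewrite !(crossvE, mxE); ring.
Qed.

Lemma qnorm2_eq0 q : (qnorm2 q == 0) = (q == 0).
Proof.
rewrite qnorm2E dotvE; apply/eqP/eqP => [|->]; last by rewrite !mxE; ring.
case: q => a u /= h.
have [/eqP ha /eqP h0 /eqP h1 /eqP h2] :
    [/\ a ^+ 2 == 0, u 0 0 ^+ 2 == 0, u 1 0 ^+ 2 == 0 & u 2 0 ^+ 2 == 0].
  have := sqr_ge0 a; have := sqr_ge0 (u 0 0).
  have := sqr_ge0 (u 1 0); have := sqr_ge0 (u 2 0).
  by move: h; rewrite -!expr2 => h *; split; apply/eqP; lra.
have z (x : R) : x ^+ 2 = 0 -> x = 0.
  by move=> /eqP; rewrite sqrf_eq0 => /eqP.
by congr pair; [exact: z | apply: cv3P; rewrite [RHS]mxE; exact: z].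
Qed.

Definition qinv q : quat R := (qnorm2 q)^-1 *: qconj q.

Lemma qscaleAl (a : R) p q : a *: (p * q) = (a *: p) * q.
Proof.
congr pair; first by rewrite /= !dotvE !mxE /GRing.scale /=; ring.
by apply: cv3P; rewrite /= !(crossvE, mxE) /GRing.scale /=; ring.
Qed.

Lemma qscaleAr (a : R) p q : a *: (p * q) = p * (a *: q).
Proof.
congr pair; first by rewrite /= !dotvE !mxE /GRing.scale /=; ring.
by apply: cv3P; rewrite /= !(crossvE, mxE) /GRing.scale /=; ring.
Qed.

Fact mulVq : {in [pred q | q != 0], left_inverse 1 qinv *%R}.
Proof.
move=> q /=; rewrite inE => q0.
by rewrite -qscaleAl mul_conjq scalerA mulVf ?qnorm2_eq0// scale1r.
Qed.

Fact mulqV : {in [pred q | q != 0], right_inverse 1 qinv *%R}.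
Proof.
move=> q /=; rewrite inE => q0.
by rewrite -qscaleAr mulq_conj scalerA mulVf ?qnorm2_eq0// scale1r.
Qed.

Fact qunitP p q : q * p = 1 /\ p * q = 1 -> [pred q | q != 0] p.
Proof.
case=> /= qp _; apply/eqP => p0.
by move/eqP: qp; rewrite p0 mulr0 eq_sym oner_eq0.
Qed.

Fact qinv_out : {in [predC [pred q : quat R | q != 0]], qinv =1 id}.
Proof.
move=> q /=; rewrite !inE negbK => /eqP ->; rewrite /qinv.
by rewrite (_ : qconj 0 = 0) ?scaler0// /qconj /= oppr0.
Qed.

HB.instance Definition _ :=
  GRing.Lmodule_isLalgebra.Build R (quat R) qscaleAl.
HB.instance Definition _ :=
  GRing.Lalgebra_isAlgebra.Build R (quat R) qscaleAr.
HB.instance Definition _ :=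
  GRing.NzRing_hasMulInverse.Build (quat R) mulVq mulqV qunitP qinv_out.

Definition SU2 : set (quat R) := [set q | qnorm2 q = 1].

(* The double cover SU(2) -> SO(3): the matrix of x |-> q x q^-1 on R^3. *)
Definition SU2_cover (q : quat R) : 'M[R]_3 :=
  mxcol_of (fun x => (q * imq x * q^-1).2).

End Quaternions.

Definition osplit (R : realType) : Type := (quat R * quat R)%type.

(* Only the module structure is transported: the library would also provide the
   componentwise product, which is not the one of the split octonions. *)
HB.instance Definition _ (R : realType) :=
  GRing.Lmodule.copy (osplit R) (quat R * quat R)%type.

Section SplitOctonions.
Variable R : realType.
Implicit Types x y : osplit R.

Definition omul x y : osplit R :=
  let: (a, b) := x in let: (c, d) := y in
  (a * c + d * qconj b, qconj a * d + c * b).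

Definition oconj x : osplit R := (qconj x.1, - x.2).

Definition Qform x : R := qnorm2 x.1 - qnorm2 x.2.

Definition Im_osplit : set (osplit R) := [set x | oconj x = - x].

Definition nullcone : set (osplit R) := [set x | Im_osplit x /\ Qform x = 0].

Definition G2split : set (osplit R -> osplit R) :=
  [set g | [/\ linear g, bijective g & {morph g : x y / omul x y >-> omul x y}]].

(* The class of x modulo R^*, as a subset of the split octonions. *)
Definition pclass x : set (osplit R) := [set y | exists2 c : R, c != 0 & y = c *: x].

Definition PC : set (set (osplit R)) :=
  [set X | exists x, [/\ nullcone x, x != 0 & X = pclass x]].

(* The action of a linear map on PC: g sends the class of x to that of g x. *)
Definition PC_act (g : osplit R -> osplit R) (X : set (osplit R)) :
  set (osplit R) := g @` X.

Lemma PC_actE g x : G2split g -> PC_act g (pclass x) = pclass (g x).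
Proof.
case=> lin_g _ _; have gZ (c : R) z : g (c *: z) = c *: g z.
  have g0 : g 0 = 0.
    by have := lin_g (-1) 0 0; rewrite scaler0 addr0 scaleN1r addNr.
  by rewrite -[c *: z]addr0 lin_g g0 addr0.
apply/seteqP; split=> y.
  by case=> _ [c c0 ->] <-; exists c => //; rewrite gZ.
by case=> c c0 ->; exists (c *: x); [exists c | rewrite gZ].
Qed.

End SplitOctonions.

Section Lines.
Variable R : realType.
Implicit Type rad : R.

Definition line_S2xSO3 rad (L : set ('cV[R]_3 * 'M[R]_3)) : Prop :=
  exists u v g, [/\ dotv u u = 1, dotv v v = 1, dotv u v = 0, SO3 g &
    L = [set (cos phi *: u + sin phi *: v,
              rotmx (crossv u v) ((1 + rad) * phi) *m g) | phi in [set: R]]].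

Definition cover_preimage (L : set ('cV[R]_3 * 'M[R]_3)) :
    set ('cV[R]_3 * quat R) :=
  [set z | [/\ S2 z.1, SU2 z.2 & L (z.1, SU2_cover z.2)]].

(* The inverse image of a line may be disconnected: for rad = 3 it consists of
   two disjoint circles, exchanged by (v, q) |-> (v, - q), each of which is
   mapped bijectively onto the line. A line upstairs is one component; the
   automorphisms of the split octonions permute the components coming from all
   lines, but do not respect the pairs formed by the two components over the
   same line. *)
Definition line_S2xSU2 rad (L : set ('cV[R]_3 * quat R)) : Prop :=
  exists2 M, line_S2xSO3 rad M &
  exists2 z, cover_preimage M z & L = connected_component (cover_preimage M) z.

(* The point +-v of RP^2, as the set {v, - v}. *)
Definition pm (v : 'cV[R]_3) : set 'cV[R]_3 := [set v; - v].

Definition line_RP2xSU2 rad (L : set (set 'cV[R]_3 * quat R)) : Prop :=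
  exists2 M, line_S2xSU2 rad M & L = (fun z => (pm z.1, z.2)) @` M.

(* tau (+-v, q) = +-(v, v q), see tauE. *)
Definition tau (z : set 'cV[R]_3 * quat R) : set (osplit R) :=
  \bigcup_(v in z.1) pclass (imq v, imq v * z.2).

Lemma tauE v q : tau (pm v, q) = pclass (imq v, imq v * q).
Proof.
apply/seteqP; split=> [y [w /= wv]|y vy]; last by exists v => //; left.
case: wv => -> [c c0 ->]; first by exists c.
have imqN : imq (- v) = - imq v by congr pair; rewrite /= oppr0.
exists (- c); rewrite ?oppr_eq0//; rewrite imqN.
by congr pair; rewrite /= scaleNr ?mulNr scalerN.
Qed.

Definition line_PC rad (L : set (set (osplit R))) : Prop :=
  exists2 M, line_RP2xSU2 rad M & L = tau @` M.

End Lines.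

(* G is a group under composition, and act is an action of G on X. *)
Definition group_action (T U : Type) (G : set (T -> T))
    (act : (T -> T) -> U -> U) (X : set U) : Prop :=
  [/\ G id,
      forall g h, G g -> G h -> G (g \o h),
      forall g, G g -> exists h, [/\ G h, cancel g h & cancel h g],
      forall g x, G g -> X x -> X (act g x) &
      (forall x, X x -> act id x = x) /\
      (forall g h x, G g -> G h -> X x -> act (g \o h) x = act g (act h x))].

(* Main.v *)
Require Import Defs.
From HB Require Import structures.
From mathcomp Require Import all_boot all_order all_algebra.
From mathcomp Require Import all_classical all_reals all_analysis.
From mathcomp Require Import ring lra.

(** Lines in PC for the ratio 3 have a description by the product of the split
    octonions alone, and so are permuted by the automorphisms: they are exactly
    the projectivizations of the planes of imaginary split octonions on which
    the product vanishes ([line_PC_3P]).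

    From lines to planes. Let [u], [v] be orthonormal, [w] their cross product
    and [q] a unit quaternion. The component through a given point of the
    preimage in S^2 x SU(2) of a line is a circle of points [(x, e q)], with
    [x = cos t u + sin t v] and [e] the exponential of [2 t w]
    ([line_S2xSU2_3P]); the other component is its image by the sign of the
    second factor, separated from it by the continuous function [sheet]. In the
    quaternions, [x e = cos t u - sin t v] ([great_circle_qexp]), hence [tau]
    sends the point to the class of
      [(x, x e q) = cos t (u, u q) + sin t (v, - v q)].
    So the line is the projectivization of the span of [(u, u q)] and
    [(v, - v q)], and a direct computation shows that the product vanishes on
    this span ([null_basis_fst_snd]).

    From planes to lines. Let [x], [y] be independent imaginary vectors with
    [x x = 0] and [x y = 0]. Changing the basis of their span, one may assume
    that their first components [u], [v] are orthonormal. Then [x x = 0] gives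
    [x = (u, u q)] for a unit quaternion [q], and [x y = 0] forces
    [y = (v, - v q)] ([null_basis_orthonormal], [null_basis_normal]).

    Automorphisms preserve these planes because they preserve imaginary vectors,
    which can be told from their squares; the same argument shows that they
    preserve the quadratic form ([G2_Im]). *)

Set Implicit Arguments.
Unset Strict Implicit.
Unset Printing Implicit Defensive.

Import Order.TTheory GRing.Theory Num.Theory.
Import numFieldNormedType.Exports.

Local Open Scope classical_set_scope.
Local Open Scope ring_scope.

(** * Quaternions and the double cover of SO(3) *)

Section VectorsAndQuaternions.
Variable R : realType.
Implicit Types (u v w : 'cV[R]_3) (p q : quat R).

Lemma dotvC u v : dotv u v = dotv v u.
Proof. by rewrite !dotvE; ring. Qed.

Lemma dotvDr u v w : dotv u (v + w) = dotv u v + dotv u w.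
Proof. by rewrite !dotvE !mxE; ring. Qed.

Lemma dotvDl u v w : dotv (u + v) w = dotv u w + dotv v w.
Proof. by rewrite !dotvE !mxE; ring. Qed.

Lemma dotvZr (a : R) u v : dotv u (a *: v) = a * dotv u v.
Proof. by rewrite !dotvE !mxE; ring. Qed.

Lemma dotvZl (a : R) u v : dotv (a *: u) v = a * dotv u v.
Proof. by rewrite !dotvE !mxE; ring. Qed.

Lemma dotvv_ge0 u : 0 <= dotv u u.
Proof. by rewrite dotvE -!expr2 !addr_ge0 ?sqr_ge0. Qed.

Lemma dotv_crossv u v :
  dotv (crossv u v) (crossv u v) = dotv u u * dotv v v - dotv u v ^+ 2.
Proof. by rewrite !dotvE !crossvE; ring. Qed.

Lemma crossv_crossv u v w :
  crossv u (crossv v w) = dotv u w *: v - dotv u v *: w.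
Proof. by apply: cv3P; rewrite !dotvE !(crossvE, mxE); ring. Qed.

Lemma dotv_crossl u v : dotv u (crossv u v) = 0.
Proof. by rewrite dotvE !crossvE; ring. Qed.

Lemma dotv_crossr u v : dotv v (crossv u v) = 0.
Proof. by rewrite dotvE !crossvE; ring. Qed.

Lemma imqD u v : imq (u + v) = imq u + imq v.
Proof. by congr pair; rewrite /= addr0. Qed.

Lemma imqZ (a : R) u : imq (a *: u) = a *: imq u.
Proof. by congr pair; rewrite /= /GRing.scale /= mulr0. Qed.

Lemma imq_mul u v :
  imq u * imq v = - dotv u v *: (1 : quat R) + imq (crossv u v).
Proof.
congr pair; first by rewrite /= /GRing.scale /=; ring.
by apply: cv3P; rewrite /= !(crossvE, mxE); ring.
Qed.

Lemma imq_sqr u : imq u * imq u = - dotv u u *: (1 : quat R).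
Proof.
rewrite imq_mul (_ : crossv u u = 0) ?addr0//.
by apply: cv3P; rewrite !(crossvE, mxE); ring.
Qed.

Lemma imq_anticomm u v : dotv u v = 0 -> imq u * imq v = - (imq v * imq u).
Proof.
move=> uv; rewrite !imq_mul (dotvC v) uv oppr0 !scale0r !add0r.
by congr pair; rewrite /= ?oppr0//; apply: cv3P; rewrite !(crossvE, mxE); ring.
Qed.

Lemma qconj_imq u : qconj (imq u) = - imq u.
Proof. by congr pair; rewrite /= oppr0. Qed.

Lemma qnorm2_imq u : qnorm2 (imq u) = dotv u u.
Proof. by rewrite qnorm2E /= expr0n add0r. Qed.

Lemma qnorm2M p q : qnorm2 (p * q) = qnorm2 p * qnorm2 q.
Proof.
by case: p q => a u [b v]; rewrite !qnorm2E /= !dotvE !(crossvE, mxE); ring.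
Qed.

Lemma qnorm2N q : qnorm2 (- q) = qnorm2 q.
Proof. by rewrite !qnorm2E /= !dotvE !mxE; ring. Qed.

Lemma qconjM p q : qconj (p * q) = qconj q * qconj p.
Proof.
case: p q => a u [b v]; congr pair; first by rewrite /= !dotvE !mxE; ring.
by apply: cv3P; rewrite /= !(crossvE, mxE); ring.
Qed.

Lemma qnorm2_conj q : qnorm2 (qconj q) = qnorm2 q.
Proof. by rewrite !qnorm2E /= !dotvE !mxE; ring. Qed.

Lemma qconjD p q : qconj (p + q) = qconj p + qconj q.
Proof. by congr pair; rewrite /= opprD. Qed.

Lemma qconjZ (k : R) q : qconj (k *: q) = k *: qconj q.
Proof. by congr pair; rewrite /= scalerN. Qed.

Lemma qnorm2_unit q : qnorm2 q = 1 -> q \is a GRing.unit.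
Proof.
move=> q1; suff: q != 0 by [].
by rewrite -qnorm2_eq0 q1 oner_eq0.
Qed.

Lemma qinvE q : qnorm2 q = 1 -> q^-1 = qconj q.
Proof.
move=> q1; have -> : q^-1 = (qnorm2 q)^-1 *: qconj q by [].
by rewrite q1 invr1 scale1r.
Qed.

(** For a unit vector [w], the exponential of [t w] in the quaternions. *)
Definition qexp w (t : R) : quat R := (cos t, sin t *: w).

Lemma qnorm2_qexp w t : dotv w w = 1 -> qnorm2 (qexp w t) = 1.
Proof.
move=> w1; rewrite qnorm2E /= dotvZl dotvZr w1 mulr1 -expr2.
exact: cos2Dsin2.
Qed.

Lemma qexpD w s t : dotv w w = 1 -> qexp w (s + t) = qexp w s * qexp w t.
Proof.
move=> w1; congr pair; first by rewrite /= cosD dotvZl dotvZr w1 mulr1.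
apply: cv3P; rewrite /= !(crossvE, mxE) sinD; ring.
Qed.

Lemma qexp0 w : qexp w 0 = 1.
Proof. by rewrite /qexp cos0 sin0 scale0r. Qed.

Lemma qexp_mul w t q :
  qexp w t * q = cos t *: q + sin t *: (imq w * q).
Proof.
have -> : qexp w t = cos t *: 1 + sin t *: imq w.
  congr pair; first by rewrite /= /GRing.scale /=; ring.
  by rewrite /= scaler0 add0r.
by rewrite mulrDl -!qscaleAl mul1r.
Qed.

Lemma SU2_coverE q : qnorm2 q = 1 ->
  SU2_cover q = mxcol_of (fun x => (q.1 ^+ 2 - dotv q.2 q.2) *: x
     + (2 * q.1) *: crossv q.2 x + (2 * dotv q.2 x) *: q.2).
Proof.
case: q => a v q1; rewrite /SU2_cover (qinvE q1); congr mxcol_of.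
by apply/funext => x; apply: cv3P; rewrite /= !dotvE !(crossvE, mxE); ring.
Qed.

Lemma mxcol_of_mul (f : 'cV[R]_3 -> 'cV[R]_3) x :
  linear f -> mxcol_of f *m x = f x.
Proof.
move=> lf.
pose F : {linear 'cV[R]_3 -> 'cV[R]_3} :=
  HB.pack f (GRing.isLinear.Build _ _ _ _ f lf).
have FE : f =1 F by [].
rewrite !FE [x in RHS](matrix_sum_delta x).
rewrite linear_sum; apply/matrixP => i j; rewrite ord1 mxE summxE.
apply: eq_bigr => k _; rewrite big_ord1 linearZ !mxE FE; exact: mulrC.
Qed.

Lemma linear_conj q : linear (fun x : 'cV[R]_3 => (q * imq x * q^-1).2).
Proof.
move=> a x y.
by rewrite imqD imqZ mulrDr mulrDl -qscaleAr -qscaleAl.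
Qed.

Lemma SU2_cover_mul q x : SU2_cover q *m x = (q * imq x * q^-1).2.
Proof. by rewrite mxcol_of_mul//; exact: linear_conj. Qed.

Lemma imq_conj q x : qnorm2 q = 1 ->
  imq (SU2_cover q *m x) = q * imq x * q^-1.
Proof.
move=> q1; rewrite SU2_cover_mul (qinvE q1); case: q q1 => a v _.
by congr pair; rewrite /= !dotvE !(crossvE, mxE); ring.
Qed.

Lemma imq_inj : injective (@imq R).
Proof. by move=> u v []. Qed.

Lemma eq_mulmx_cV (A B : 'M[R]_3) :
  (forall x : 'cV[R]_3, A *m x = B *m x) -> A = B.
Proof.
move=> AB; apply/matrixP => i j.
have /matrixP /(_ i 0) := AB (delta_mx j 0).
by rewrite -!colE !mxE.
Qed.

Lemma SU2_coverM p q : qnorm2 p = 1 -> qnorm2 q = 1 ->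
  SU2_cover (p * q) = SU2_cover p *m SU2_cover q.
Proof.
move=> p1 q1; apply: eq_mulmx_cV => x; apply: imq_inj.
rewrite -mulmxA !imq_conj// ?qnorm2M ?p1 ?q1 ?mulr1//.
by rewrite invrM ?qnorm2_unit// !mulrA.
Qed.

Lemma SU2_cover1 : SU2_cover (1 : quat R) = 1%:M.
Proof.
apply: eq_mulmx_cV => x; rewrite SU2_cover_mul.
by rewrite invr1 mulr1 mul1r mul1mx.
Qed.

Lemma SU2_coverN q : SU2_cover (- q) = SU2_cover q.
Proof.
by apply: eq_mulmx_cV => x; rewrite !SU2_cover_mul invrN mulrN !mulNr opprK.
Qed.

Lemma SU2_cover_qexp w t : dotv w w = 1 ->
  SU2_cover (qexp w t) = rotmx w (2 * t).
Proof.
move=> w1; rewrite (SU2_coverE (qnorm2_qexp t w1)); congr mxcol_of.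
apply/funext => x /=; rewrite !dotvZl dotvZr w1 mulr1.
have -> : 2 * t = t + t by ring.
have c1 : cos t ^+ 2 = 1 - sin t ^+ 2 by rewrite -(cos2Dsin2 t) addrK.
by apply: cv3P; rewrite !(crossvE, mxE) cosD sinD -!expr2 c1; ring.
Qed.

(** A unit quaternion in the kernel commutes with every imaginary one, so its
    imaginary part has zero cross product with every vector and vanishes. *)
Lemma SU2_cover_eq1 q : qnorm2 q = 1 -> SU2_cover q = 1%:M ->
  q = 1 \/ q = -1.
Proof.
move=> q1 q_1.
have qC x : q * imq x = imq x * q.
  rewrite -[in RHS](mul1mx x) -q_1 imq_conj//.
  by rewrite mulrVK// qnorm2_unit.
case: q q1 {q_1} qC => a v; rewrite qnorm2E /= => q1 qC.
have cross0 x : crossv v x = 0.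
  have [_] := qC x; rewrite scale0r addr0 add0r => /addrI vx.
  have xv : crossv x v = - crossv v x.
    by apply: cv3P; rewrite !(crossvE, mxE); ring.
  apply/eqP; move: vx => /eqP; rewrite xv -subr_eq0 opprK -mulr2n.
  by rewrite -scaler_nat scaler_eq0 pnatr_eq0.
have v0 : v = 0.
  have := cross0 (delta_mx 0 0); have := cross0 (delta_mx 1 0).
  move=> /matrixP e1 /matrixP e0.
  have := e0 1 0; have := e0 2 0; have := e1 0 0; have := e1 2 0.
  rewrite !(crossvE, mxE) /= => *.
  by apply: cv3P; rewrite mxE; lra.
move: q1; rewrite v0 dotvE !mxE !mulr0 !addr0 => /eqP.
rewrite sqrf_eq1 => /orP[] /eqP ->; [left|right] => //.
by congr pair; rewrite /= oppr0.
Qed.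

Lemma SU2_cover_inj p q : qnorm2 p = 1 -> qnorm2 q = 1 ->
  SU2_cover p = SU2_cover q -> p = q \/ p = - q.
Proof.
move=> p1 q1 pq; have q'1 : qnorm2 q^-1 = 1.
  by rewrite qinvE// qnorm2_conj.
have qu := qnorm2_unit q1.
have [||e|e] := @SU2_cover_eq1 (p * q^-1).
- by rewrite qnorm2M p1 q'1 mulr1.
- by rewrite SU2_coverM// pq -SU2_coverM// divrr// SU2_cover1.
- by left; rewrite -(divrK qu p) e mul1r.
- by right; rewrite -(divrK qu p) e mulN1r.
Qed.

Lemma ord3P (P : 'I_3 -> Prop) : P 0 -> P 1 -> P 2 -> forall i, P i.
Proof.
move=> P0 P1 P2 [[|[|[|//]]] lt_i].
- by rewrite (_ : Ordinal lt_i = 0) //; apply: val_inj.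
- by rewrite (_ : Ordinal lt_i = 1) //; apply: val_inj.
- by rewrite (_ : Ordinal lt_i = 2) //; apply: val_inj.
Qed.

Lemma SU2_cover_conj q : qnorm2 q = 1 -> SU2_cover (qconj q) = (SU2_cover q)^T.
Proof.
move=> q1; rewrite !SU2_coverE ?qnorm2_conj//; case: q {q1} => a v /=.
apply/matrixP; elim/ord3P; elim/ord3P;
  rewrite !(crossvE, mxE) !dotvE !mxE /=; ring.
Qed.

Lemma det3 (A : 'M[R]_3) : \det A =
  A 0 0 * (A 1 1 * A 2 2 - A 1 2 * A 2 1)
  - A 0 1 * (A 1 0 * A 2 2 - A 1 2 * A 2 0)
  + A 0 2 * (A 1 0 * A 2 1 - A 1 1 * A 2 0).
Proof.
rewrite (expand_det_row _ 0) !big_ord_recl big_ord0 /cofactor.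
rewrite !(expand_det_row _ 0) !big_ord_recl !big_ord0 /cofactor !det_mx11.
rewrite !mxE.
(* Over [nat], the nested lifts that index the minors compute. *)
pose f (i j : nat) := A (inord i) (inord j).
have Af i j : A i j = f i j by rewrite /f !inord_val.
rewrite !Af /= /bump /=; ring.
Qed.

(** Conjugating the quaternion transposes the matrix, hence orthogonality; the
    determinant is the polynomial [qnorm2 q ^+ 3]. *)
Lemma SO3_SU2_cover q : qnorm2 q = 1 -> SO3 (SU2_cover q).
Proof.
move=> q1; split.
  rewrite -SU2_cover_conj// -SU2_coverM//.
    by rewrite mulq_conj q1 scale1r SU2_cover1.
  by rewrite qnorm2_conj.
have -> : 1 = qnorm2 q ^+ 3 by rewrite q1 expr1n.
rewrite det3 SU2_coverE// qnorm2E; case: q {q1} => a v /=.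
rewrite !(crossvE, mxE) !dotvE !mxE /=; ring.
Qed.

End VectorsAndQuaternions.

(** * Lines upstairs: the components of the preimage of a line *)

Section LiftedLines.
Variable R : realType.
Implicit Types (u v w : 'cV[R]_3) (p q : quat R).

Definition orthonormal_pair u v :=
  [/\ dotv u u = 1, dotv v v = 1 & dotv u v = 0].

Definition great_circle u v (t : R) := cos t *: u + sin t *: v.

(** The line of [line_S2xSO3] at [rad = 3], in the syntactic form that its
    definition produces. *)
Definition rolling_line u v (g : 'M[R]_3) : set ('cV[R]_3 * 'M[R]_3) :=
  [set (great_circle u v t, rotmx (crossv u v) ((1 + 3) * t) *m g)
     | t in [set: R]].

(** The rotation by [4 t] about the cross product of [u] and [v] is covered by
    its exponential at half the angle, [2 t]. *)
Definition lifted_line u v q : set ('cV[R]_3 * quat R) :=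
  [set (great_circle u v t, qexp (crossv u v) (2 * t) * q) | t in [set: R]].

Lemma crossv_unit u v : orthonormal_pair u v ->
  dotv (crossv u v) (crossv u v) = 1.
Proof. by case=> u1 v1 uv; rewrite dotv_crossv u1 v1 uv expr0n subr0 mulr1. Qed.

Lemma dotv_great_circle u v t : orthonormal_pair u v ->
  (dotv u (great_circle u v t) = cos t) * (dotv v (great_circle u v t) = sin t).
Proof.
case=> u1 v1 uv; rewrite !dotvDr !dotvZr u1 v1 (dotvC v u) uv.
by rewrite !mulr0 !mulr1 addr0 add0r.
Qed.

Lemma great_circle_unit u v t : orthonormal_pair u v ->
  dotv (great_circle u v t) (great_circle u v t) = 1.
Proof.
move=> uv; rewrite {1}/great_circle dotvDl !dotvZl !dotv_great_circle//.
by rewrite -!expr2 cos2Dsin2.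
Qed.

Lemma rotmx_qexp w t q : dotv w w = 1 -> qnorm2 q = 1 ->
  rotmx w ((1 + 3) * t) *m SU2_cover q = SU2_cover (qexp w (2 * t) * q).
Proof.
move=> w1 q1; rewrite SU2_coverM ?qnorm2_qexp// SU2_cover_qexp//.
by congr (rotmx w _ *m _); ring.
Qed.

Lemma cover_preimage_rolling_line u v q :
  orthonormal_pair u v -> qnorm2 q = 1 ->
  cover_preimage (rolling_line u v (SU2_cover q)) =
  lifted_line u v q `|` lifted_line u v (- q).
Proof.
move=> uv q1; have w1 := crossv_unit uv.
have e1 t : qnorm2 (qexp (crossv u v) (2 * t) * q) = 1.
  by rewrite qnorm2M qnorm2_qexp// mul1r.
apply/seteqP; split=> [[x p]|z zL].
  case=> /= _ p1 [t _ [<-]]; rewrite rotmx_qexp// => /esym.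
  move=> /(SU2_cover_inj p1 (e1 t)) [->|->]; [left|right]; exists t => //.
  by rewrite mulrN.
have [t [zt zq]] : exists t, z.1 = great_circle u v t /\
    (z.2 = qexp (crossv u v) (2 * t) * q \/
     z.2 = - (qexp (crossv u v) (2 * t) * q)).
  by case: zL => -[t _ <-]; exists t; split=> //; [left | right; rewrite mulrN].
split; first by rewrite /S2 /= zt great_circle_unit.
  by case: zq => ->; rewrite /SU2 /= ?qnorm2N.
exists t => //; rewrite zt rotmx_qexp//.
by case: zq => ->; rewrite ?SU2_coverN.
Qed.

Definition qdot p q : R := p.1 * q.1 + dotv p.2 q.2.

Lemma qdotqq q : qdot q q = qnorm2 q.
Proof. by rewrite qnorm2E expr2. Qed.

Lemma qdotNl p q : qdot (- p) q = - qdot p q.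
Proof. by rewrite /qdot /= !dotvE !mxE; ring. Qed.

Lemma qdotDr p q1 q2 : qdot p (q1 + q2) = qdot p q1 + qdot p q2.
Proof. by rewrite /qdot /= !dotvE !mxE; ring. Qed.

Lemma qdotZr p (a : R) q : qdot p (a *: q) = a * qdot p q.
Proof. by rewrite /qdot /= !dotvE !mxE /GRing.scale /=; ring. Qed.

(** On [lifted_line u v q] the coordinates of [z.1] on [u] and [v] are the cosine
    and the sine of [t], so the point of the lift above [z.1] can be recovered as
    a quadratic expression in [z.1], without choosing [t]. This is its inner
    product with [z.2]: 1 on that circle, -1 on the opposite one. *)
Definition sheet u v q (z : 'cV[R]_3 * quat R) : R :=
  (dotv u z.1 ^+ 2 - dotv v z.1 ^+ 2) * qdot z.2 q
  + 2 * dotv u z.1 * dotv v z.1 * qdot z.2 (imq (crossv u v) * q).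

Lemma sheetE u v q t p : orthonormal_pair u v ->
  sheet u v q (great_circle u v t, p) =
  qdot p (qexp (crossv u v) (2 * t) * q).
Proof.
move=> uv; rewrite /sheet /= !dotv_great_circle// qexp_mul qdotDr !qdotZr.
have -> : 2 * t = t + t by ring.
by rewrite cosD sinD; ring.
Qed.

Lemma sheet_lifted_line u v q z : orthonormal_pair u v -> qnorm2 q = 1 ->
  lifted_line u v q z -> sheet u v q z = 1.
Proof.
move=> uv q1 [t _ <-]; rewrite sheetE// qdotqq qnorm2M q1 mulr1.
by rewrite qnorm2_qexp// crossv_unit.
Qed.

Lemma sheet_lifted_lineN u v q z : orthonormal_pair u v -> qnorm2 q = 1 ->
  lifted_line u v (- q) z -> sheet u v q z = -1.
Proof.
move=> uv q1 [t _ <-]; rewrite sheetE// mulrN qdotNl qdotqq qnorm2M q1 mulr1.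
by rewrite qnorm2_qexp// crossv_unit.
Qed.

Lemma dotv_continuous u : continuous (dotv u).
Proof.
have -> : dotv u = fun x => u 0 0 * x 0 0 + u 1 0 * x 1 0 + u 2 0 * x 2 0.
  by apply/funext => x; rewrite dotvE.
have ci i : continuous (fun x : 'cV[R]_3 => u i 0 * x i 0).
  move=> x.
  by apply: continuousM; [exact: cst_continuous|exact: coord_continuous].
move=> x; apply: (@cvgD R R^o _ (nbhs x)); last exact: ci.
by apply: (@cvgD R R^o _ (nbhs x)); exact: ci.
Qed.

Lemma qdot_continuous q : continuous (fun p : quat R => qdot p q).
Proof.
have -> : (fun p => qdot p q) = fun p : quat R => p.1 * q.1 + dotv q.2 p.2.
  by apply/funext => p; rewrite /qdot dotvC.
move=> p; apply: (@cvgD R R^o _ (nbhs p)).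
  by apply: continuousM; [exact: cvg_fst|exact: cst_continuous].
apply: (@continuous_comp _ _ _ (fun p : quat R => p.2) (dotv q.2)).
  exact: cvg_snd.
exact: dotv_continuous.
Qed.

Lemma sheet_continuous u v q : continuous (sheet u v q).
Proof.
have dot1 w : continuous (fun z : 'cV[R]_3 * quat R => dotv w z.1).
  move=> z; apply: (@continuous_comp _ _ _ fst (dotv w)).
    exact: cvg_fst.
  exact: dotv_continuous.
have dot2 p : continuous (fun z : 'cV[R]_3 * quat R => qdot z.2 p).
  move=> z; apply: (@continuous_comp _ _ _ snd (fun p' => qdot p' p)).
    exact: cvg_snd.
  exact: qdot_continuous.
move=> z; apply: (@cvgD R R^o _ (nbhs z)).
  apply: (@cvgM R _ (nbhs z)); last exact: dot2.
  by apply: (@cvgB R R^o _ (nbhs z)); apply: (@cvgM R _ (nbhs z)); exact: dot1.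
apply: (@cvgM R _ (nbhs z)); last exact: dot2.
apply: (@cvgM R _ (nbhs z)); last exact: dot1.
by apply: (@cvgM R _ (nbhs z)); [exact: cvg_cst|exact: dot1].
Qed.

Lemma lifted_line_connected u v q : connected (lifted_line u v q).
Proof.
apply: connected_continuous_connected; first by apply/connected_intervalP.
apply: continuous_subspaceT => t.
have lin2 : {for t, continuous (fun t : R => 2 * t)}.
  by apply: continuousM; [exact: cst_continuous|exact: cvg_id].
have cos2 : {for t, continuous (fun t : R => cos (2 * t))}.
  exact: continuous_comp lin2 (@continuous_cos _ _).
have sin2 : {for t, continuous (fun t : R => sin (2 * t))}.
  exact: continuous_comp lin2 (@continuous_sin _ _).
have circle_cts : great_circle u v x @[x --> t] --> great_circle u v t.
  apply: (@cvgD R 'cV[R]_3 _ (nbhs t)); apply: cvgZr_tmp.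
    exact: continuous_cos.
  exact: continuous_sin.
set w := crossv u v.
have re_cts : cos (2 * x) * q.1 + sin (2 * x) * (imq w * q).1 @[x --> t] -->
    cos (2 * t) * q.1 + sin (2 * t) * (imq w * q).1.
  by apply: (@cvgD R R^o _ (nbhs t)); (apply: cvgM; last exact: cvg_cst).
have im_cts : cos (2 * x) *: q.2 + sin (2 * x) *: (imq w * q).2 @[x --> t] -->
    cos (2 * t) *: q.2 + sin (2 * t) *: (imq w * q).2.
  by apply: (@cvgD R 'cV[R]_3 _ (nbhs t)); apply: cvgZr_tmp.
under eq_fun do rewrite qexp_mul.
exact: cvg_pair circle_cts (cvg_pair re_cts im_cts).
Qed.

(** The two circles over a line cannot be joined: [sheet] is continuous and takes
    only the values 1 and -1 on their union. *)
Lemma connected_component_rolling_line u v q z :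
  orthonormal_pair u v -> qnorm2 q = 1 -> lifted_line u v q z ->
  connected_component (cover_preimage (rolling_line u v (SU2_cover q))) z =
  lifted_line u v q.
Proof.
move=> uv q1 zq; rewrite cover_preimage_rolling_line//.
set P := _ `|` _; apply/seteqP; split; last first.
  by apply: connected_component_max => //;
    [move=> y; left|exact: lifted_line_connected].
move=> y Cy; have [//|yN] : P y by exact: connected_component_sub Cy.
have sheetC : is_interval (sheet u v q @` connected_component P z).
  apply/connected_intervalP/connected_continuous_connected.
    exact: component_connected.
  exact/continuous_subspaceT/sheet_continuous.
have sheet_y : (sheet u v q @` connected_component P z) (-1).
  by exists y => //; exact: sheet_lifted_lineN.
have sheet_z : (sheet u v q @` connected_component P z) 1.
  exists z; last exact: sheet_lifted_line.
  by apply: connected_component_refl; left.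
have [|x /connected_component_sub Px x0] := sheetC _ _ sheet_y sheet_z 0.
  by rewrite lerN10 ler01.
have : sheet u v q x != 0.
  case: Px => [/(sheet_lifted_line uv q1)|/(sheet_lifted_lineN uv q1)] ->.
    by rewrite oner_eq0.
  by rewrite oppr_eq0 oner_eq0.
by rewrite x0 eqxx.
Qed.

(** A component comes with a point [(x, p)] on it; turning [p] back along the
    line produces a quaternion over the matrix [g]. *)
Lemma line_S2xSU2_3P (L : set ('cV[R]_3 * quat R)) :
  line_S2xSU2 3 L <->
  exists u v q, [/\ orthonormal_pair u v, qnorm2 q = 1 & L = lifted_line u v q].
Proof.
split=> [[_ [u [v [g [u1 v1 uv _ ->]]]] [[x p]]]|].
  rewrite -/(rolling_line u v g) => -[/= _ p1 [t _ [xt gp]]] ->.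
  have ON : orthonormal_pair u v by split.
  have w1 := crossv_unit ON.
  pose q := qexp (crossv u v) (- (2 * t)) * p.
  have pE : p = qexp (crossv u v) (2 * t) * q.
    by rewrite mulrA -qexpD// subrr qexp0 mul1r.
  have q1 : qnorm2 q = 1 by rewrite qnorm2M qnorm2_qexp// mul1r.
  exists u, v, q; split=> //.
  have gE : g = SU2_cover q.
    rewrite SU2_coverM ?qnorm2_qexp// -gp SU2_cover_qexp// mulmxA.
    rewrite (_ : (1 + 3) * t = 2 * (2 * t)); last by ring.
    rewrite -!SU2_cover_qexp// -SU2_coverM ?qnorm2_qexp// -qexpD//.
    by rewrite addNr qexp0 SU2_cover1 mul1mx.
  rewrite gE; apply: connected_component_rolling_line => //.
  by exists t => //; rewrite -pE -xt.
case=> u [v [q [ON q1 ->]]]; have [u1 v1 uv] := ON.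
exists (rolling_line u v (SU2_cover q)).
  by exists u, v, (SU2_cover q); split=> //; exact: SO3_SU2_cover.
have L0 : lifted_line u v q (great_circle u v 0, qexp (crossv u v) (2 * 0) * q).
  by exists 0.
exists (great_circle u v 0, qexp (crossv u v) (2 * 0) * q).
  by rewrite cover_preimage_rolling_line//; left.
by rewrite connected_component_rolling_line.
Qed.

End LiftedLines.

(** * Lines in PC are projectivized null subalgebras *)

Section NullSubalgebras.
Variable R : realType.
Implicit Types (u v w : 'cV[R]_3) (q : quat R) (x y z : osplit R).

Lemma polar (a b : R) : (a, b) != (0, 0) ->
  exists r t, [/\ r != 0, a = r * cos t & b = r * sin t].
Proof.
move=> ab0; pose r := Num.sqrt (a ^+ 2 + b ^+ 2).
have s0 : 0 < a ^+ 2 + b ^+ 2.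
  rewrite lt_neqAle addr_ge0 ?sqr_ge0// andbT eq_sym paddr_eq0 ?sqr_ge0//.
  by rewrite !sqrf_eq0.
have r0 : 0 < r by rewrite sqrtr_gt0.
have r2 : r ^+ 2 = a ^+ 2 + b ^+ 2 by rewrite sqr_sqrtr// ltW.
have ar : (a / r) ^+ 2 = 1 - (b / r) ^+ 2.
  by rewrite !expr_div_n r2; field; rewrite gt_eqF.
have a1 : -1 <= a / r <= 1.
  by rewrite -ler_norml -(@ler_pXn2r _ 2)// ?nnegrE// expr1n real_normK
    ?num_real// ar gerBl sqr_ge0.
have cosE : a = r * cos (acos (a / r)).
  by rewrite acosK// mulrC divfK// gt_eqF.
have sinE : sin (acos (a / r)) = `|b| / r.
  rewrite sin_acos// ar opprB addrC subrK sqrtr_sqr normrM.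
  by rewrite normfV (gtr0_norm r0).
have r_neq0 : r != 0 by rewrite gt_eqF.
have [b0|b0] := leP 0 b; [exists r, (acos (a / r))|exists r, (- acos (a / r))].
  by split=> //; rewrite sinE ger0_norm// mulrC divfK.
by split=> //; rewrite ?cosN// sinN sinE ltr0_norm// mulNr opprK mulrC divfK.
Qed.

Lemma omulDr x y z : omul x (y + z) = omul x y + omul x z.
Proof.
case: x y z => a b [c d] [e f]; rewrite /omul /=.
by congr pair; rewrite /= !(mulrDr, mulrDl) addrACA.
Qed.

Lemma omulDl x y z : omul (x + y) z = omul x z + omul y z.
Proof.
case: x y z => a b [c d] [e f]; rewrite /omul /=.
by congr pair; rewrite /= !qconjD !(mulrDr, mulrDl) addrACA.
Qed.

Lemma omulZr (k : R) x y : omul x (k *: y) = k *: omul x y.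
Proof.
case: x y => a b [c d]; rewrite /omul /=.
by congr pair; rewrite /= scalerDr -qscaleAr -qscaleAl.
Qed.

Lemma omulZl (k : R) x y : omul (k *: x) y = k *: omul x y.
Proof.
case: x y => a b [c d]; rewrite /omul /=.
by congr pair; rewrite /= !qconjZ scalerDr -qscaleAr -qscaleAl.
Qed.

Definition span2 x y : set (osplit R) :=
  [set z | exists a b : R, z = a *: x + b *: y].

Definition projectivization (V : set (osplit R)) : set (set (osplit R)) :=
  [set pclass z | z in [set z | V z /\ z != 0]].

(** A basis of a plane in the imaginary split octonions on which the product is
    identically zero. Two products suffice: [omul y x = 0] follows by
    conjugation, and [omul y y = 0] by solving [omul x y = 0] for the second
    component of [y], which gets the norm of the first. *)
Definition null_basis x y :=
  [/\ Im_osplit x /\ Im_osplit y, omul x x = 0, omul x y = 0, x != 0 &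
      forall k : R, y <> k *: x].

(** For orthonormal [u], [v] and a unit quaternion [q], the pair [null_fst u q],
    [null_snd v q] is the normal form of a null basis. *)
Definition null_fst u q : osplit R := (imq u, imq u * q).
Definition null_snd v q : osplit R := (imq v, - (imq v * q)).

Lemma pclassZ (k : R) x : k != 0 -> pclass (k *: x) = pclass x.
Proof.
move=> k0; apply/seteqP; split=> _ [c c0 ->].
  by exists (c * k); rewrite ?mulf_neq0// scalerA.
by exists (c / k); rewrite ?mulf_neq0 ?invr_eq0// scalerA divfK.
Qed.

(** The place where [rad = 3] matters. Writing [x] for the point of the circle,
    right multiplication by [qexp w (2 * t)] turns [x] back by [2 t] in the plane
    of [u] and [v], that is, to the point of parameter [- t]: the result is again
    linear in [(cos t, sin t)]. *)
Lemma great_circle_qexp u v t : orthonormal_pair u v ->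
  imq (great_circle u v t) * qexp (crossv u v) (2 * t) =
  imq (cos t *: u - sin t *: v).
Proof.
move=> uv; rewrite -[qexp _ _]mulr1 qexp_mul mulr1 mulrDr.
rewrite -!qscaleAr mulr1 imq_mul.
rewrite crossv_crossv !(dotvC (great_circle u v t)) !dotv_great_circle//.
have -> : dotv (crossv u v) (great_circle u v t) = 0.
  by rewrite dotvDr !dotvZr !(dotvC (crossv u v)) dotv_crossl dotv_crossr;
    rewrite !mulr0 addr0.
rewrite oppr0 scale0r add0r -!imqZ -imqD; congr imq.
transitivity ((cos (2 * t) * cos t + sin (2 * t) * sin t) *: u
              - (sin (2 * t) * cos t - cos (2 * t) * sin t) *: v).
  by rewrite /great_circle; apply: cv3P; rewrite !mxE; ring.
by rewrite -cosB -sinB (_ : 2 * t - t = t)//; ring.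
Qed.

Lemma tau_lifted_line u v q t : orthonormal_pair u v ->
  tau (pm (great_circle u v t), qexp (crossv u v) (2 * t) * q) =
  pclass (cos t *: null_fst u q + sin t *: null_snd v q).
Proof.
move=> uv; rewrite tauE mulrA great_circle_qexp//; congr pclass.
congr pair; first by rewrite imqD !imqZ.
rewrite imqD -scaleNr !imqZ mulrDl -!qscaleAl /=.
by rewrite scalerN scaleNr.
Qed.

(** A curve [cos t *: x + sin t *: y] meets every line through 0 in the span of
    [x] and [y], by polar coordinates. *)
Lemma image_tau_lifted_line u v q : orthonormal_pair u v ->
  @tau R @` ((fun z : 'cV[R]_3 * quat R => (pm z.1, z.2)) @` lifted_line u v q) =
  projectivization (span2 (null_fst u q) (null_snd v q)).
Proof.
move=> uv; rewrite image_comp; apply/seteqP; split=> X.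
  case=> _ [t _ <-] <- /=; rewrite tau_lifted_line//.
  exists (cos t *: null_fst u q + sin t *: null_snd v q) => //; split.
    by exists (cos t), (sin t).
  apply/eqP => /(congr1 (fun z => z.1.2)) /= gc0.
  have := great_circle_unit t uv; rewrite /great_circle gc0 dotvE !mxE !mulr0.
  by move/eqP; rewrite !addr0 eq_sym oner_eq0.
case=> z [[a [b ->]] z0] <-.
have [|r [t [r0 -> ->]]] := @polar a b.
  by apply: contraNneq z0 => -[-> ->]; rewrite !scale0r addr0.
rewrite -!scalerA -scalerDr pclassZ// -tau_lifted_line//.
by exists (great_circle u v t, qexp (crossv u v) (2 * t) * q) => //; exists t.
Qed.

Lemma line_PC_3_orthonormal (L : set (set (osplit R))) : line_PC 3 L <->
  exists u v q, [/\ orthonormal_pair u v, qnorm2 q = 1 &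
    L = projectivization (span2 (null_fst u q) (null_snd v q))].
Proof.
split=> [[_ [_ /line_S2xSU2_3P [u [v [q [uv q1 ->]]]] ->] ->]|].
  by exists u, v, q; split=> //; rewrite image_tau_lifted_line.
case=> u [v [q [uv q1 ->]]].
exists ((fun z : 'cV[R]_3 * quat R => (pm z.1, z.2)) @` lifted_line u v q).
  by exists (lifted_line u v q) => //; apply/line_S2xSU2_3P; exists u, v, q.
by rewrite image_tau_lifted_line.
Qed.

Lemma Im_osplitP x : Im_osplit x <-> exists u b, x = (imq u, b).
Proof.
split=> [|[u [b ->]]]; last by congr pair; rewrite /= qconj_imq.
case: x => [[a u] b] /(congr1 (fun z => z.1.1)) /= aN; exists u, b.
by congr (_, _, _); lra.
Qed.

Lemma null_basis_fst_snd u v q : orthonormal_pair u v -> qnorm2 q = 1 ->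
  null_basis (null_fst u q) (null_snd v q).
Proof.
case=> u1 v1 uv q1; split.
- by split; apply/Im_osplitP; [exists u, (imq u * q)|exists v, (- (imq v * q))].
- rewrite /omul /null_fst qconj_imq imq_sqr u1 mulq_conj qnorm2M qnorm2_imq u1.
  by rewrite q1 mulr1 scale1r scaleN1r addNr mulNr addNr.
- have vu := imq_anticomm uv.
  rewrite /omul /null_fst /null_snd qconjM !qconj_imq.
  congr pair; last by rewrite mulrNN !mulrA vu mulNr addNr.
  rewrite mulrN mulrNN -mulrA (mulrA q) mulq_conj q1 scale1r mul1r.
  by rewrite vu addNr.
- apply/eqP => -[u0 _]; move: u1; rewrite u0 dotvE !mxE !mulr0 !addr0.
  by move/eqP; rewrite eq_sym oner_eq0.
move=> k -[_ vE _]; move: v1; rewrite {2}vE dotvZr dotvC uv mulr0.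
by move/eqP; rewrite eq_sym oner_eq0.
Qed.

(** The equation [omul x x = 0] says that the two components of [x] have the same
    norm, which yields [q]; the first component of [omul x y = 0] can then be
    solved for [d]. *)
Lemma null_basis_orthonormal u v b d : orthonormal_pair u v ->
  null_basis (imq u, b) (imq v, d) ->
  exists q,
  [/\ qnorm2 q = 1, (imq u, b) = null_fst u q & (imq v, d) = null_snd v q].
Proof.
move=> [u1 v1 uv] [_ xx xy _ _].
have b1 : qnorm2 b = 1.
  have : imq u * imq u + b * qconj b = 0.
    by have := congr1 (fun z : osplit R => z.1) xx.
  rewrite imq_sqr u1 mulq_conj -scalerDl => /eqP; rewrite scaler_eq0 oner_eq0.
  by rewrite orbF addrC subr_eq0 => /eqP.
have bE : b = imq u * (- (imq u * b)).
  by rewrite mulrN mulrA imq_sqr u1 scaleN1r mulN1r opprK.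
exists (- (imq u * b)); split.
- by rewrite qnorm2N qnorm2M qnorm2_imq u1 b1 mulr1.
- by rewrite /null_fst -bE.
congr pair => /=.
have xy1 : imq u * imq v + d * qconj b = 0.
  by have := congr1 (fun z : osplit R => z.1) xy.
have /eqP := congr1 ( *%R^~ b) xy1; rewrite mulrDl mul0r -[d * _ * b]mulrA.
rewrite mul_conjq b1 scale1r mulr1 addr_eq0 => /eqP uvb.
rewrite mulrN opprK mulrA -[LHS]opprK -uvb.
by rewrite (imq_anticomm uv) mulNr opprK.
Qed.

End NullSubalgebras.

(** * Normal form of a null basis *)

Section Normalization.
Variable R : realType.
Implicit Types (u v w : 'cV[R]_3) (q : quat R) (x y z : osplit R).

Lemma Im_osplitD x y : Im_osplit x -> Im_osplit y -> Im_osplit (x + y).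
Proof.
move=> /Im_osplitP[u [b ->]] /Im_osplitP[v [d ->]]; apply/Im_osplitP.
by exists (u + v), (b + d); rewrite imqD.
Qed.

Lemma Im_osplitZ (k : R) x : Im_osplit x -> Im_osplit (k *: x).
Proof.
move=> /Im_osplitP[u [b ->]]; apply/Im_osplitP.
by exists (k *: u), (k *: b); rewrite imqZ.
Qed.

Lemma null_basis_shear (s t k : R) x y : s != 0 -> t != 0 ->
  null_basis x y -> null_basis (s *: x) (t *: (y + k *: x)).
Proof.
move=> s0 t0 [[Ix Iy] xx xy x0 yx]; split.
- by split; apply: Im_osplitZ => //; apply: Im_osplitD => //; exact: Im_osplitZ.
- by rewrite omulZl omulZr xx !scaler0.
- by rewrite omulZl omulZr omulDr omulZr xx xy scaler0 addr0 !scaler0.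
- by rewrite scaler_eq0 negb_or s0.
move=> l yl; apply: (yx (t^-1 * (l * s) - k)).
by rewrite scalerBl -!scalerA -yl [t^-1 *: _]scalerA mulVf// scale1r addrK.
Qed.

Lemma span2_shear (s t k : R) x y : s != 0 -> t != 0 ->
  span2 (s *: x) (t *: (y + k *: x)) = span2 x y.
Proof.
move=> s0 t0; apply/seteqP; split=> _ [a [b ->]].
  exists (a * s + b * t * k), (b * t).
  by rewrite scalerDl scalerDr scalerDr !scalerA addrAC addrA.
exists ((a - b * k) / s), (b / t).
rewrite !scalerA !divfK// scalerDr scalerA scalerBl [b *: y + _]addrC addrA.
by rewrite subrK.
Qed.

(** On the null cone both components have the same norm, so the first one
    determines whether a vector is zero. *)
Lemma null_vector_fst u b : omul (imq u, b) (imq u, b) = 0 ->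
  (imq u, b) != 0 :> osplit R -> 0 < dotv u u.
Proof.
move=> xx; rewrite lt_neqAle dotvv_ge0 andbT; apply: contra_neq => /esym u0.
have b0 : imq u * imq u + b * qconj b = 0.
  by have := congr1 (fun z : osplit R => z.1) xx.
move: b0; rewrite imq_sqr u0 oppr0 scale0r add0r mulq_conj => /eqP.
rewrite scaler_eq0 oner_eq0 orbF qnorm2_eq0 => /eqP ->.
by move: u0; rewrite -qnorm2_imq => /eqP; rewrite qnorm2_eq0 => /eqP ->.
Qed.

(** If [v] were zero, [omul x y = 0] would read [d * qconj b = 0], forcing
    [d = 0] since [b] is invertible. After the subtraction of a multiple of [x] from
    [y], this is what makes the first components independent. *)
Lemma null_basis_im2_neq0 u v b d : null_basis (imq u, b) (imq v, d) -> v != 0.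
Proof.
move=> [_ xx xy x0 yx]; apply: contra_notN (yx 0) => /eqP v0.
have imq0 : imq 0 = 0 :> quat R by [].
rewrite v0 imq0 scale0r; congr pair.
have db : d * qconj b = 0.
  have := congr1 (fun z : osplit R => z.1) xy.
  by rewrite /omul v0 imq0 mulr0 add0r.
have b0 : qnorm2 b != 0.
  have b2 : imq u * imq u + b * qconj b = 0.
    by have := congr1 (fun z : osplit R => z.1) xx.
  move: b2; rewrite imq_sqr mulq_conj -scalerDl => /eqP.
  rewrite scaler_eq0 oner_eq0 orbF addrC subr_eq0 => /eqP ->.
  by rewrite gt_eqF// (null_vector_fst xx).
have /eqP := congr1 ( *%R^~ b) db.
rewrite mul0r -mulrA mul_conjq -qscaleAr mulr1 scaler_eq0 (negbTE b0).
by move/eqP.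
Qed.

(** Gram-Schmidt on the first components, performed on the whole vectors. *)
Lemma null_basis_normal x y : null_basis x y ->
  exists u v q, [/\ orthonormal_pair u v, qnorm2 q = 1 &
    span2 x y = span2 (null_fst u q) (null_snd v q)].
Proof.
move=> xyN; have [[Ix Iy] xx _ x0 _] := xyN.
have /Im_osplitP[a [b xE]] := Ix; have /Im_osplitP[c [d yE]] := Iy.
subst x y; have a0 := null_vector_fst xx x0.
pose n := (Num.sqrt (dotv a a))^-1.
have n0 : n != 0 by rewrite invr_eq0 gt_eqF// sqrtr_gt0.
have n2 : n ^+ 2 * dotv a a = 1.
  by rewrite exprVn sqr_sqrtr ?dotvv_ge0// mulVf// gt_eqF.
pose k := - (dotv a c / dotv a a).
have yE t : t *: ((imq c, d) + k *: (imq a, b)) =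
    (imq (t *: (c + k *: a)), t *: (d + k *: b)) :> osplit R.
  by rewrite imqZ imqD imqZ.
have xE : n *: (imq a, b) = (imq (n *: a), n *: b) :> osplit R by rewrite imqZ.
have c'0 : c + k *: a != 0.
  have := null_basis_shear k n0 (oner_neq0 R) xyN.
  by rewrite xE yE scale1r => /null_basis_im2_neq0.
pose m := (Num.sqrt (dotv (c + k *: a) (c + k *: a)))^-1.
have c'1 : 0 < dotv (c + k *: a) (c + k *: a).
  rewrite lt_neqAle dotvv_ge0 andbT eq_sym -qnorm2_imq qnorm2_eq0.
  by apply: contra_neq c'0 => -[].
have m0 : m != 0 by rewrite invr_eq0 gt_eqF// sqrtr_gt0.
have m2 : m ^+ 2 * dotv (c + k *: a) (c + k *: a) = 1.
  by rewrite exprVn sqr_sqrtr ?dotvv_ge0// mulVf// gt_eqF.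
have uv : orthonormal_pair (n *: a) (m *: (c + k *: a)).
  split; rewrite dotvZl dotvZr; [by rewrite mulrA -expr2..|].
  by rewrite dotvDr dotvZr mulNr divfK ?gt_eqF// subrr !mulr0.
have := null_basis_shear k n0 m0 xyN; rewrite xE yE.
move=> /(null_basis_orthonormal uv)[q [q1 xq yq]].
exists (n *: a), (m *: (c + k *: a)), q; split=> //.
by rewrite -(span2_shear k _ _ n0 m0) -xq -yq xE yE.
Qed.

Lemma line_PC_3P (L : set (set (osplit R))) : line_PC 3 L <->
  exists x y, null_basis x y /\ L = projectivization (span2 x y).
Proof.
rewrite line_PC_3_orthonormal; split=> [[u [v [q [uv q1 ->]]]]|].
  exists (null_fst u q), (null_snd v q); split=> //.
  exact: null_basis_fst_snd.
move=> [x [y [xyN ->]]].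
have [u [v [q [uv q1 ->]]]] := null_basis_normal xyN.
by exists u, v, q.
Qed.

End Normalization.

(** * Automorphisms of the split octonions *)

Section Automorphisms.
Variable R : realType.
Implicit Types (x y z : osplit R) (g h : osplit R -> osplit R).

Definition oone : osplit R := (1, 0).

Lemma omul1 x : omul oone x = x.
Proof.
case: x => a b; rewrite /omul /oone; congr pair; rewrite ?mul1r.
  have -> : qconj 0 = 0 :> quat R by congr pair; rewrite /= oppr0.
  by rewrite mulr0 addr0.
have -> : qconj 1 = 1 :> quat R by congr pair; rewrite /= oppr0.
by rewrite mul1r mulr0 addr0.
Qed.

Lemma omulx1 x : omul x oone = x.
Proof.
by case: x => a b; rewrite /omul /oone; congr pair;
  rewrite ?mulr0 ?mul0r ?mulr1 ?addr0 ?add0r ?mul1r.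
Qed.

Lemma omul_sqr_Im x : Im_osplit x -> omul x x = - Qform x *: oone.
Proof.
move=> /Im_osplitP[u [b ->]]; rewrite /omul /oone /Qform /= qconj_imq.
rewrite imq_sqr mulq_conj -scalerDl mulNr addNr.
by congr pair; rewrite ?scaler0// qnorm2_imq opprB addrC.
Qed.

Lemma omul_sqr (a : R) x : Im_osplit x ->
  omul (a *: oone + x) (a *: oone + x) =
  (a ^+ 2 - Qform x) *: oone + (2 * a) *: x.
Proof.
move=> Ix.
rewrite omulDr !omulDl !omulZl !omulZr !omul1 omulx1 omul_sqr_Im//.
rewrite scalerA -expr2 (_ : 2 * a = a + a); last by ring.
by rewrite !scalerDl [a *: x + - _ *: _]addrC addrACA.
Qed.

Lemma scalar_Im (a : R) x : Im_osplit x -> a *: oone + x = 0 -> a = 0.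
Proof.
move=> /Im_osplitP[u [b ->]] /(congr1 (fun z => z.1.1)) /=.
by rewrite /GRing.scale /= mulr1 addr0.
Qed.

Lemma scalar_Im_decomp x : exists (a : R) y, Im_osplit y /\ x = a *: oone + y.
Proof.
case: x => [[a u] b]; exists a, (imq u, b); split.
  by apply/Im_osplitP; exists u, b.
congr pair; last by rewrite /= scaler0 add0r.
congr pair; first by rewrite /= /GRing.scale /= mulr1 addr0.
by rewrite /= scaler0 add0r.
Qed.

Section OneAutomorphism.
Variables (g : osplit R -> osplit R) (Gg : G2split g).

Lemma G2_0 : g 0 = 0.
Proof.
have [lg _ _] := Gg.
by have := lg (-1) 0 0; rewrite scaler0 addr0 scaleN1r addNr.
Qed.

Lemma G2_Z (k : R) x : g (k *: x) = k *: g x.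
Proof. by have [lg _ _] := Gg; rewrite -[k *: x]addr0 lg G2_0 addr0. Qed.

Lemma G2_D x y : g (x + y) = g x + g y.
Proof. by have [lg _ _] := Gg; rewrite -[x]scale1r lg !scale1r. Qed.

Lemma G2_inj : injective g.
Proof. by have [_ /bij_inj] := Gg. Qed.

Lemma G2_M x y : g (omul x y) = omul (g x) (g y).
Proof. by have [_ _ ->] := Gg. Qed.

Lemma G2_1 : g oone = oone.
Proof.
have [_ [h gK hK] _] := Gg.
by rewrite -[LHS]omulx1 -[X in omul _ X]hK -G2_M omul1 hK.
Qed.

(** Imaginary vectors are recognized by their squares: [x] squares to the scalar
    [- Qform x], whereas [a + y] with [y] imaginary has a scalar square only if
    [a = 0] or [y = 0]; the second case would make [x] itself a scalar. *)
Lemma G2_Im x : Im_osplit x -> Im_osplit (g x) /\ Qform (g x) = Qform x.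
Proof.
move=> Ix; have [a [y [Iy gx]]] := scalar_Im_decomp (g x).
have sqr : (a ^+ 2 - Qform y + Qform x) *: oone + (2 * a) *: y = 0.
  have := G2_M x x; rewrite omul_sqr_Im// G2_Z G2_1 gx omul_sqr// => e.
  by rewrite scalerDl addrAC -e scaleNr addNr.
have e1 : a ^+ 2 - Qform y + Qform x = 0.
  by apply: scalar_Im sqr; exact: Im_osplitZ.
have : (2 * a) *: y == 0 by move: sqr; rewrite e1 scale0r add0r => ->.
rewrite scaler_eq0 mulf_eq0 pnatr_eq0 /= => /orP[|] /eqP y0.
  have gy : g x = y by rewrite gx y0 scale0r add0r.
  by rewrite gy; split=> //; move: e1; rewrite y0; lra.
have xa : x = a *: oone by apply: G2_inj; rewrite gx y0 addr0 G2_Z G2_1.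
have a0 : a = 0.
  apply: (scalar_Im (x := - x)); last by rewrite -xa subrr.
  by rewrite -scaleN1r; exact: Im_osplitZ.
rewrite xa a0 scale0r G2_0; split=> //.
by rewrite -[0](scale0r x); exact: Im_osplitZ.
Qed.

Lemma G2_null_basis x y : null_basis x y -> null_basis (g x) (g y).
Proof.
move=> [[Ix Iy] xx xy x0 yx]; split.
- by split; apply: (proj1 (G2_Im _)).
- by rewrite -G2_M xx G2_0.
- by rewrite -G2_M xy G2_0.
- by apply: contra_neq x0 => gx; apply: G2_inj; rewrite gx G2_0.
by move=> k; rewrite -G2_Z => /G2_inj; exact: yx.
Qed.

Lemma G2_projectivization x y :
  PC_act g @` projectivization (span2 x y) =
  projectivization (span2 (g x) (g y)).
Proof.
apply/seteqP; split=> X.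
  case=> _ [z [[a [b zE]] z0] <-] <-; rewrite PC_actE//.
  exists (g z) => //; split; first by exists a, b; rewrite zE G2_D !G2_Z.
  by apply: contra_neq z0 => gz; apply: G2_inj; rewrite gz G2_0.
case=> _ [[a [b ->]] z0] <-.
have gab : g (a *: x + b *: y) = a *: g x + b *: g y by rewrite G2_D !G2_Z.
exists (pclass (a *: x + b *: y)); last by rewrite PC_actE// gab.
exists (a *: x + b *: y) => //; split; first by exists a, b.
by apply: contra_neq z0 => ab0; rewrite -gab ab0 G2_0.
Qed.

Lemma G2_PC X : PC X -> PC (PC_act g X).
Proof.
case=> x [[Ix Qx] x0 ->]; rewrite PC_actE//; exists (g x); split=> //.
  by have [Igx Qgx] := G2_Im Ix; split=> //; rewrite Qgx.
by apply: contra_neq x0 => gx; apply: G2_inj; rewrite gx G2_0.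
Qed.

Lemma G2_inv : exists h, [/\ G2split h, cancel g h & cancel h g].
Proof.
have [_ [h gK hK] _] := Gg; exists h; split=> //; split.
- by move=> a x y; apply: G2_inj; rewrite hK G2_D G2_Z !hK.
- by exists g.
- by move=> x y; apply: G2_inj; rewrite G2_M !hK.
Qed.

End OneAutomorphism.

Lemma G2_group_action : group_action (@G2split R) (@PC_act R) (@PC R).
Proof.
split.
- by split=> //; exists id.
- move=> g h Gg Gh; split=> [a x y||x y] /=.
  + by rewrite (G2_D Gh) (G2_Z Gh) (G2_D Gg) (G2_Z Gg).
  + by have [_ bg _] := Gg; have [_ bh _] := Gh; exact: bij_comp.
  + by rewrite (G2_M Gh) (G2_M Gg).
- exact: G2_inv.
- by move=> g X Gg; exact: G2_PC.
- by split=> [X _|g h X _ _ _]; rewrite /PC_act ?image_id// image_comp.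
Qed.

End Automorphisms.

Theorem corollary6 (R : realType) :
  [/\ forall (g : osplit R -> osplit R) (x : osplit R), G2split g ->
        Im_osplit x -> Im_osplit (g x) /\ Qform (g x) = Qform x,
      group_action (@G2split R) (@PC_act R) (@PC R) &
      forall (g : osplit R -> osplit R) (L : set (set (osplit R))),
        G2split g -> line_PC (3 : R) L -> line_PC (3 : R) (PC_act g @` L)].
Proof.
split; first by move=> g x Gg; exact: G2_Im.
  exact: G2_group_action.
move=> g L Gg /line_PC_3P[x [y [xyN ->]]]; apply/line_PC_3P.
exists (g x), (g y); split; first exact: G2_null_basis.
exact: G2_projectivization.
Qed.
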